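(* Let $B_n(x)$ be the type $B$ Eulerian polynomials. For $n\ge1$, $$B_n(x)=\sum_{T\in\mathrm{SYT}(n)}\left(\prod_{i=1}^n\sigma_i(T)\,c_i^{w_i(T)}\right)x^{\frac12\left(n-\ell(\lambda(T))\right)},$$ where $c_{2i-1}=4^{i-1}(1+x)$ and $c_{2i}=4^i\sqrt x$ for $i\ge1$.
   Context: $B_n(x)=\sum_{\sigma\in\mathcal B_n}x^{\mathrm{des}_B(\sigma)}$, where $\mathcal B_n$ is the hyperoctahedral group of signed permutations $\sigma=\sigma(1)\cdots\sigma(n)$ of $\{\pm1,\dots,\pm n\}$ (with $\sigma(-i)=-\sigma(i)$) and $\mathrm{des}_B(\sigma)=\#\{i\in\{0,1,\dots,n-1\}:\sigma(i)>\sigma(i+1)\}$ with $\sigma(0)=0$. A standard Young tableau of size $n$ is a filling of the Ferrers diagram of a partition $\lambda\vdash n$ (French convention: left-justified rows numbered from bottom to top, $\lambda_i$ boxes in row $i$) with $1,\dots,n$, each used exactly once, increasing from left to right in rows and from bottom to top in columns; $\mathrm{SYT}(n)$ is the set of all of them, over all $\lambda\vdash n$. For $T\in\mathrm{SYT}(n)$, $\ell(\lambda(T))$ is the number of rows of $T$, $w_i(T)$ is the number of rows of $T$ with exactly $i$ boxes, $T_i$ is the tableau obtained from $T$ by deleting the entries $i+1,\dots,n$, and $\mathrm{col}_k(T_i)$ is the number of boxes in the $k$-th column of $T_i$. The box sorting index of $i$ is $$\sigma_i(T)=\begin{cases} i-\mathrm{col}_1(T_i)+1, & \text{if } i \text{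 is in the first column of } T,\\ \mathrm{col}_k(T_i)-\mathrm{col}_{k+1}(T_i)+1, & \text{if } i \text{ is in the } (k+1)\text{-th column of } T,\ k\ge1.\end{cases}$$ *)

(* Defs.v *)
From mathcomp Require Export all_boot all_order all_fingroup all_algebra.

Set Implicit Arguments.
Unset Strict Implicit.
Unset Printing Implicit Defensive.

Import Order.TTheory GRing.Theory Num.Theory.
Local Open Scope ring_scope.

(* The set {±1, ..., ±n}: (i, b) : 'I_n * bool stands for the integer of
   absolute value i + 1, negative exactly when b holds. *)
Notation signed n := ('I_n * bool)%type.

Definition signed_val (n : nat) (u : signed n) : int :=
  if u.2 then - (u.1.+1)%:Z else (u.1.+1)%:Z.

Definition sopp (n : nat) (u : signed n) : signed n := (u.1, ~~ u.2).

Definition hyperoctahedral (n : nat) : {set {perm signed n}} :=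
  [set s : {perm signed n} | [forall u, s (sopp u) == sopp (s u)]].

(* The sequence s(0), s(1), ..., s(n), with s(0) = 0. *)
Definition sword (n : nat) (s : {perm signed n}) : seq int :=
  0 :: [seq signed_val (s (i, false)) | i <- enum 'I_n].

Definition desB (n : nat) (s : {perm signed n}) : nat :=
  #|[set i : 'I_n | (sword s)`_i > (sword s)`_i.+1]|.

Definition eulerianB (R : comNzRingType) (n : nat) : {poly R} :=
  \sum_(s in hyperoctahedral n) 'X^(desB s).

(* A filling is an n x n array: T r c is the entry of the box in row r
   (counted from the bottom) and column c, and 0 means that there is no box. *)
Notation filling n := 'M['I_n.+1]_n.

Section Tableaux.
Variable n : nat.
Implicit Type T : filling n.

Definition box T (b : 'I_n * 'I_n) : bool := (T b.1 b.2 != 0 :> nat)%N.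

Definition rowlen T (r : 'I_n) : nat := #|[set c : 'I_n | box T (r, c)]|.

Definition ferrers T : bool :=
  [forall r : 'I_n, forall c : 'I_n, box T (r, c) == (c < rowlen T r)%N]
  && [forall r : 'I_n, forall r' : 'I_n,
        (r <= r')%N ==> (rowlen T r' <= rowlen T r)%N].

Definition entries_once T : bool :=
  [forall i : 'I_n.+1, (i != 0 :> nat)%N ==>
     (#|[set b : 'I_n * 'I_n | T b.1 b.2 == i]| == 1)%N].

Definition rows_increasing T : bool :=
  [forall r : 'I_n, forall c : 'I_n, forall c' : 'I_n,
     ((c < c')%N && box T (r, c')) ==> (T r c < T r c')%N].

Definition cols_increasing T : bool :=
  [forall r : 'I_n, forall r' : 'I_n, forall c : 'I_n,
     ((r < r')%N && box T (r', c)) ==> (T r c < T r' c)%N].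

(* The number of boxes is n because each of 1, ..., n fills exactly one box. *)
Definition SYT : {set filling n} :=
  [set T : filling n | [&& ferrers T, entries_once T,
                           rows_increasing T & cols_increasing T]].

Definition nrows T : nat := #|[set r : 'I_n | (0 < rowlen T r)%N]|.

Definition nrows_of_len T (i : nat) : nat :=
  #|[set r : 'I_n | rowlen T r == i]|.

Definition restrict T (i : nat) : filling n :=
  \matrix_(r, c) if (T r c <= i)%N then T r c else ord0.

(* Columns are numbered from 1. *)
Definition col_len (k : nat) T : nat :=
  #|[set b : 'I_n * 'I_n | (b.2.+1 == k) && box T b]|.

(* The number of the column containing i; 0 when i does not occur in T. *)
Definition col_of T (i : nat) : nat :=
  if [pick b : 'I_n * 'I_n | T b.1 b.2 == i :> nat] is Some b
  then b.2.+1 else 0%N.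

(* On standard tableaux neither subtraction truncates: the first column of
   T_i has at most i boxes, and column lengths weakly decrease. *)
Definition box_sorting T (i : nat) : nat :=
  let Ti := restrict T i in
  let k := (col_of T i).-1 in
  if k == 0%N then (i - col_len 1 Ti + 1)%N
  else (col_len k Ti - col_len k.+1 Ti + 1)%N.

End Tableaux.

(* c_(2j-1) = 4^(j-1) (1 + x) and c_(2j) = 4^j sqrtx; in both cases the
   exponent of 4 is half the index, rounded down. *)
Definition cweight (R : comNzRingType) (x sqrtx : R) (i : nat) : R :=
  4%:R ^+ i./2 * (if odd i then 1 + x else sqrtx).

(* Main.v *)
Require Import Defs.
From mathcomp Require Import zify ring.
Import Order.TTheory GRing.Theory Num.Theory.
Local Open Scope ring_scope.

Set Implicit Arguments.
Unset Strict Implicit.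
Unset Printing Implicit Defensive.

(** Both sides satisfy the recurrence
    [B_(m+1) = (1 + (2m+1) X) B_m + 2 X (1 - X) B_m'] with [B_0 = 1].

    For signed permutations it counts the ways of inserting the letters [m+1]
    and [-(m+1)] into a word ([eulerianBS]).

    For tableaux, the product of the box sorting indices is the coefficient met
    when the operator [c D] is iterated on [c].  After [m] steps one has a
    product of [m+1] factors, each a derivative of [c]; a row of length [k > 0]
    records a factor differentiated [k] times, and the remaining [m+1-l] factors
    are plain copies of [c], where [l] is the number of rows.  A new box in a row
    of length [k] differentiates one of the factors of order [k], and its
    sorting index is exactly the number of these factors
    ([box_sorting_add_new]).

    The weights are the derivatives [c_k] of a function with [c_0 = sqrt x],
    [c_1 = 1 + x] and [c_(k+2) = 4 c_k].  Consequently only the parity of the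
    row lengths matters: if a tableau with [m] boxes has [q] odd rows and
    [m = q + 2j], its weight is the gamma term [(4 x)^j (1 + x)^q]
    ([prod_cweight]).  Adding a box in all possible ways differentiates an odd
    factor in [q] ways and an even one in [2j+1] ways, and this is how the
    recurrence acts on a gamma term ([eulerB_step_gamma], [sum_add_gamma]).  The
    theorem is the case [m = n] of [eulerianB_partial_SYT]. *)

(** * The recurrence of the type B Eulerian polynomials *)

(** The operator that carries [B_m] to [B_(m+1)], that is
    [P |-> (1 + (2m+1) X) P + 2 X (1 - X) P']. *)
Definition eulerB_step (R : comNzRingType) (m : nat) (P : {poly R}) : {poly R} :=
  (1 + 'X *+ m.*2.+1) * P + ('X * (1 - 'X) * P^`()) *+ 2.

Lemma eulerB_step_sum (R : comNzRingType) (m : nat) (I : Type) (r : seq I)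
    (P : pred I) (F : I -> {poly R}) :
  eulerB_step m (\sum_(i <- r | P i) F i) = \sum_(i <- r | P i) eulerB_step m (F i).
Proof.
rewrite /eulerB_step big_split /= mulr_sumr; congr (_ + _).
by rewrite sumrMnl -mulr_sumr raddf_sum.
Qed.

Lemma eulerB_step_natZ (R : comNzRingType) (m k : nat) (P : {poly R}) :
  eulerB_step m (P *+ k) = eulerB_step m P *+ k.
Proof. by rewrite /eulerB_step derivMn !mulrnAr mulrnAC -mulrnDl. Qed.

(** On a monomial the operator reads off the insertion count: a word with [d]
    descents has [2d+1] extensions with [d] descents and [2(m-d)+1] extensions
    with [d+1] descents. *)
Lemma eulerB_stepXn (R : comNzRingType) (m d : nat) :
  (d <= m)%N ->
  eulerB_step m ('X^d : {poly R}) = 'X^d *+ d.*2.+1 + 'X^(d.+1) *+ (m - d).*2.+1.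
Proof.
move=> le_dm; rewrite /eulerB_step derivXn.
have [e -> {le_dm}] : exists e, m = (d + e)%N by exists (m - d)%N; rewrite subnKC.
have doubleE k : (k.*2.+1)%:R = 1 + 2 * k%:R :> {poly R} by rewrite mulrS -mul2n natrM.
rewrite addKn -(mulr_natr 'X) -(mulr_natr 'X^d) -(mulr_natr 'X^(d.+1)) !doubleE natrD.
rewrite -[in LHS](mulr_natr 'X^(d.-1)) -[(_ * _) *+ 2]mulr_natr; case: d => [|d] /=; first by ring.
by rewrite !exprS !mulrS; ring.
Qed.

(** * Insertion of the largest letter into a signed word *)

Section Words.

(** The leading letter [a] is kept outside the word, so that inductions on the
    word can let it vary; at the outset it is the conventional [s(0) = 0]. *)
Definition descents (a : int) (w : seq int) : nat :=
  count id (pairmap (fun u v => v < u) a w).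

Lemma descents_cons a b w : descents a (b :: w) = ((b < a)%R + descents b w)%N.
Proof. by []. Qed.

Lemma descents_le_size a w : (descents a w <= size w)%N.
Proof. by rewrite -(size_pairmap (fun u v => v < u) a w) count_size. Qed.

Fixpoint insertions (x : int) (w : seq int) : seq (seq int) :=
  if w is b :: w' then (x :: w) :: map (cons b) (insertions x w')
  else [:: [:: x]].

Lemma insertionsP (x : int) (w v : seq int) :
  reflect (exists s1 s2, w = s1 ++ s2 /\ v = s1 ++ x :: s2) (v \in insertions x w).
Proof.
elim: w v => [|b w IHw] v /=.
  rewrite inE; apply: (iffP eqP) => [->|[s1] [s2] []]; first by exists [::], [::].
  by case: s1 => [|? ?] //; case: s2.
rewrite inE; apply: (iffP orP) => [[/eqP->|/mapP[u /IHw[s1 [s2 [-> ->]]] ->]]|].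
- by exists [::], (b :: w).
- by exists (b :: s1), s2.
- move=> [[|c s1] [s2 [/= def_w ->]]]; first by left; rewrite -def_w.
  case: def_w => -> def_w; right; apply/mapP; exists (s1 ++ x :: s2) => //.
  by apply/IHw; exists s1, s2.
Qed.

Lemma insertions_uniq x w : x \notin w -> uniq (insertions x w).
Proof.
elim: w => [|b w IHw] //=; rewrite inE negb_or => /andP[neq_xb /IHw uniq_w].
rewrite map_inj_uniq ?uniq_w ?andbT; last by move=> u v [].
by apply/mapP => -[u _ [E _]]; rewrite E eqxx in neq_xb.
Qed.

(** A letter larger than all others creates exactly one descent when it is put
    between two letters, which replaces the descent that may have been there,
    and none at the end.  So the number of descents is unchanged in the
    existing descents and at the end, and grows by one in the ascents. *)
Lemma sum_insertions_pos (R : comNzRingType) (x a : int) (w : seq int) :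
  all (fun b => b < x) (a :: w) ->
  \sum_(v <- insertions x w) ('X^(descents a v) : {poly R}) =
    'X^(descents a w) *+ (descents a w).+1
    + 'X^((descents a w).+1) *+ (size w - descents a w).
Proof.
elim: w a => [|b w IHw] a /=.
  by rewrite andbT => /ltW le_ax; rewrite big_seq1 /descents /= ltNge le_ax /= addr0.
move=> /and3P[lt_ax lt_bx lt_wx]; rewrite big_cons big_map !descents_cons.
under eq_bigr do rewrite descents_cons exprD.
rewrite -mulr_sumr IHw /= ?lt_bx // (ltNge x a) (ltW lt_ax) /=.
have le_dw := descents_le_size b w; set d := descents b w in le_dw *.
case: (b < a); rewrite /= ?add1n ?add0n ?subSS ?expr1 ?expr0.
  by rewrite !mulrDr !mulrnAr -!exprS addrA [in RHS]mulrS.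
by rewrite mul1r subSn // (addrC 'X^_) -addrA -mulrSr.
Qed.

(** A letter smaller than all others behaves in the same way between two
    letters, but it creates a descent at the end of the word. *)
Lemma sum_insertions_neg (R : comNzRingType) (x a : int) (w : seq int) :
  all (fun b => x < b) (a :: w) ->
  \sum_(v <- insertions x w) ('X^(descents a v) : {poly R}) =
    'X^(descents a w) *+ descents a w
    + 'X^((descents a w).+1) *+ (size w - descents a w).+1.
Proof.
elim: w a => [|b w IHw] a /=.
  by rewrite andbT => lt_ax; rewrite big_seq1 /descents /= lt_ax /= add0r.
move=> /and3P[lt_ax lt_bx lt_wx]; rewrite big_cons big_map !descents_cons.
under eq_bigr do rewrite descents_cons exprD.
rewrite -mulr_sumr IHw /= ?lt_bx // (ltNge b x) (ltW lt_bx) lt_ax /=.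
have le_dw := descents_le_size b w; set d := descents b w in le_dw *.
case: (b < a); rewrite /= ?add1n ?add0n ?subSS ?expr1 ?expr0.
  by rewrite mulrDr !mulrnAr -!exprS addrA -mulrS.
by rewrite mul1r subSn // addrCA -mulrS.
Qed.

Fixpoint signed_words (n : nat) : seq (seq int) :=
  if n is m.+1 then
    flatten [seq insertions m.+1%:Z w ++ insertions (- m.+1%:Z) w | w <- signed_words m]
  else [:: [::]].

(** This intrinsic description of the words is what identifies them with signed
    permutations. *)
Lemma mem_signed_words n w :
  (w \in signed_words n) = perm_eq (map absz w) (iota 1 n).
Proof.
elim: n w => [|n IHn] w.
  rewrite /= inE; apply/eqP/idP => [->//|/perm_size /=]; by case: w.
have iotaS : perm_eq (iota 1 n.+1) (n.+1 :: iota 1 n).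
  by rewrite -{1}(addn1 n) iotaD /= cats1 perm_rcons add1n.
rewrite (permPr iotaS) /=; apply/flattenP/idP => [[s /mapP[u]]|perm_w].
  rewrite IHn => perm_u ->; rewrite mem_cat => in_w.
  (* From here on the sign of the inserted letter is irrelevant. *)
  have {in_w} [x [absx /insertionsP[s1 [s2 [def_u ->]]]]] :
      exists x, absz x = n.+1 /\ w \in insertions x u.
    by case/orP: in_w => ?; [exists n.+1%:Z | exists (- n.+1%:Z)].
  rewrite map_cat /= perm_catC /= absx perm_cons perm_catC -map_cat -def_u.
  exact: perm_u.
have /mapP[x x_w absx] : n.+1 \in map absz w by rewrite (perm_mem perm_w) inE eqxx.
case/splitPr: x_w perm_w => s1 s2 perm_w.
exists (insertions n.+1%:Z (s1 ++ s2) ++ insertions (- n.+1%:Z) (s1 ++ s2)).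
  apply: map_f; rewrite IHn -(perm_cons n.+1) -(permPr perm_w).
  by rewrite !map_cat /= -absx -cat1s perm_catCA.
have -> : s1 ++ x :: s2 \in insertions n.+1%:Z (s1 ++ s2)
              ++ insertions (- n.+1%:Z) (s1 ++ s2) = true => //.
have in_ins: s1 ++ x :: s2 \in insertions x (s1 ++ s2) by apply/insertionsP; exists s1, s2.
rewrite mem_cat; have: x = n.+1%:Z \/ x = - n.+1%:Z by lia.
by case=> <-; rewrite in_ins ?orbT.
Qed.

Lemma abs_lt_signed_words n w x :
  w \in signed_words n -> x \in w -> (absz x < n.+1)%N.
Proof.
rewrite mem_signed_words => perm_w x_w.
have: absz x \in map absz w by apply: map_f.
by rewrite (perm_mem perm_w) mem_iota add1n => /andP[].
Qed.

(** The shorter word and the inserted letter can be recovered from the result: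
    erase the letter of absolute value [n+1]. *)
Lemma signed_words_uniq n : uniq (signed_words n).
Proof.
elim: n => [|n IHn] //=.
have lt_words := @abs_lt_signed_words n.
elim: (signed_words n) IHn lt_words => [|w s IHs] //= /andP[w_notin_s uniq_s] lt_words.
have notin u x : u \in w :: s -> absz x = n.+1 -> x \notin u.
  by move=> u_s absx; apply/negP=> /(lt_words _ _ u_s); lia.
have recover u v : u \in w :: s ->
    v \in insertions n.+1%:Z u ++ insertions (- n.+1%:Z) u ->
    [seq z <- v | absz z != n.+1] = u.
  move=> u_s; rewrite mem_cat => in_v.
  have {in_v} [x [absx /insertionsP[s1 [s2 [def_u ->]]]]] :
      exists x, absz x = n.+1 /\ v \in insertions x u.
    by case/orP: in_v => ?; [exists n.+1%:Z | exists (- n.+1%:Z)].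
  rewrite filter_cat /= absx eqxx /= -filter_cat -def_u.
  by apply/all_filterP/allP => z z_u; apply: contraTneq (lt_words _ _ u_s z_u) => ->; lia.
rewrite cat_uniq IHs ?andbT //; last first.
  by move=> u x u_s; apply: lt_words; rewrite inE u_s orbT.
rewrite cat_uniq !insertions_uniq ?notin ?inE ?eqxx //= andbT.
apply/andP; split; apply/hasPn=> v.
  case/insertionsP=> s1 [s2 [def_w def_v]]; apply/negP=> /insertionsP[t1 [t2 [def_w' def_v']]].
  have: n.+1%:Z \in v by rewrite def_v' mem_cat inE eqxx orbT.
  have /negP := notin w n.+1%:Z (mem_head _ _) erefl.
  rewrite def_w def_v !mem_cat inE => N_notin /orP[N_in|/orP[/eqP|N_in]]; last 1 first.
  - by apply: N_notin; rewrite N_in orbT.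
  - by apply: N_notin; rewrite N_in.
  - by [].
(* Two shorter words with a common extension would be equal. *)
case/flattenP=> _ /mapP[u u_s ->] in_v; apply/negP=> in_v'.
move: w_notin_s; rewrite -(recover w v) ?inE ?eqxx // (recover u v) ?u_s //.
by rewrite inE u_s orbT.
Qed.

Lemma sum_signed_words_step (R : comNzRingType) n :
  \sum_(w <- signed_words n.+1) ('X^(descents 0 w) : {poly R}) =
  eulerB_step n (\sum_(w <- signed_words n) 'X^(descents 0 w)).
Proof.
rewrite eulerB_step_sum /= big_flatten big_map big_seq [RHS]big_seq.
apply: eq_bigr => w w_in; rewrite big_cat /=.
have lt_w := abs_lt_signed_words w_in.
rewrite sum_insertions_pos; last by apply/allP=> z; rewrite inE => /predU1P[->//|/lt_w]; lia.
rewrite sum_insertions_neg; last by apply/allP=> z; rewrite inE => /predU1P[->//|/lt_w]; lia.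
have size_w : size w = n.
  by move: w_in; rewrite mem_signed_words => /perm_size; rewrite size_map size_iota.
have := descents_le_size 0 w; rewrite size_w => le_dn.
rewrite eulerB_stepXn // addrACA -!mulrnDr addSn addnS !addnn.
done.
Qed.

End Words.

(** * Signed permutations as signed words *)

Section Hyperoctahedral.
Variable n : nat.
Implicit Type s : {perm signed n}.

Definition signed_word s : seq int := [seq signed_val (s (i, false)) | i <- enum 'I_n].

Lemma size_signed_word s : size (signed_word s) = n.
Proof. by rewrite size_map size_enum_ord. Qed.

Lemma desBE s : desB s = descents 0 (signed_word s).
Proof.
rewrite /desB /descents cardsE -sum1_card /= -sum1_count.
rewrite (big_nth false) big_mkord size_pairmap size_signed_word.
apply: eq_bigl => i; rewrite unfold_in (nth_pairmap 0) ?size_signed_word //.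
Qed.

Lemma signed_val_inj : injective (@signed_val n).
Proof.
move=> [i b] [j c]; rewrite /signed_val /=.
by case: b; case: c => E; try lia; congr (_, _); apply: val_inj => /=; lia.
Qed.

Lemma absz_signed_val (u : signed n) : absz (signed_val u) = u.1.+1.
Proof. by case: u => i []. Qed.

Lemma hyperoctahedralP s :
  reflect (forall i b, s (i, b) = ((s (i, false)).1, b (+) (s (i, false)).2))
          (s \in hyperoctahedral n).
Proof.
rewrite inE; apply: (iffP forallP) => [s_opp i [] | s_opp [i b]].
- exact: (eqP (s_opp (i, false))).
- by case: (s _).
- by rewrite /sopp /= (s_opp i b) (s_opp i (~~ b)) /= addNb.
Qed.

Lemma signed_word_in s : s \in hyperoctahedral n -> signed_word s \in signed_words n.
Proof.
move=> /hyperoctahedralP s_opp; rewrite mem_signed_words /signed_word -map_comp.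
have inj_abs : injective (fun i => (s (i, false)).1).
  move=> i j eq_ij; suff: s (i, false) = s (j, (s (j, false)).2 (+) (s (i, false)).2).
    by move/perm_inj => [].
  by rewrite (s_opp j) addbAC addbb -eq_ij; case: (s (i, false)).
rewrite (eq_map (g := succn \o (fun i => val (s (i, false)).1))); last first.
  by move=> i /=; rewrite absz_signed_val.
rewrite map_comp (iotaDl 1 0) perm_map // -val_enum_ord.
rewrite (map_comp val) perm_map //.
apply: uniq_perm; rewrite ?enum_uniq //.
  by rewrite (map_inj_uniq inj_abs) enum_uniq.
move=> i; rewrite mem_enum; apply/mapP.
exists (invF inj_abs i); [by rewrite mem_enum | exact: esym (f_invF inj_abs i)].
Qed.

Lemma signed_word_inj : {in hyperoctahedral n &, injective signed_word}.
Proof.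
move=> s t /hyperoctahedralP s_opp /hyperoctahedralP t_opp eq_st.
apply/permP=> -[i b]; rewrite (s_opp i) (t_opp i).
suff -> : s (i, false) = t (i, false) by [].
apply: signed_val_inj; move/eq_in_map: eq_st => /(_ i); apply.
by rewrite mem_enum.
Qed.

Lemma signed_word_surj w :
  w \in signed_words n -> exists2 s, s \in hyperoctahedral n & w = signed_word s.
Proof.
move=> w_in; have := w_in; rewrite mem_signed_words => perm_w.
have size_w : size w = n by have /perm_size := perm_w; rewrite size_map size_iota.
have w_pos (i : 'I_n) : (0 < absz (nth 0%R w i) <= n)%N.
  have : absz (nth 0%R w i) \in map absz w by rewrite map_f // mem_nth ?size_w.
  by rewrite (perm_mem perm_w) mem_iota add1n ltnS.
have lt_w (i : 'I_n) : ((absz (nth 0%R w i)).-1 < n)%N by have := w_pos i; lia.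
(* The sign of [w_i] composes with the sign of the argument. *)
pose f (u : signed n) : signed n := (Ordinal (lt_w u.1), u.2 (+) (w`_u.1 < 0)).
have f_inj : injective f.
  move=> [i b] [j c] []; rewrite /= => /eqP E.
  have eq_ij : i = j.
    have uniq_w : uniq (map absz w) by rewrite (perm_uniq perm_w) iota_uniq.
    apply: val_inj; apply/eqP; rewrite -(nth_uniq 0%N _ _ uniq_w) ?size_map ?size_w ?ltn_ord //.
    rewrite !(nth_map 0) ?size_w ?ltn_ord //; have := w_pos i; have := w_pos j.
    by move: E; case: absz => // k; case: absz => // l /= /eqP->.
  by rewrite eq_ij => /addIb ->.
exists (perm f_inj).
  by apply/hyperoctahedralP=> i b; rewrite !permE /f /= .
apply: (@eq_from_nth _ 0) => [|i]; rewrite ?size_signed_word size_w // => lt_in.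
rewrite (nth_map (Ordinal lt_in)) ?size_enum_ord // permE /f /signed_val /=.
rewrite nth_enum_ord //; have := w_pos (Ordinal lt_in) => /=.
case: ifP; lia.
Qed.

Lemma eulerianB_signed_words (R : comNzRingType) :
  eulerianB R n = \sum_(w <- signed_words n) 'X^(descents 0 w).
Proof.
rewrite /eulerianB -big_enum /=.
under eq_bigr do rewrite desBE; rewrite -(big_map signed_word predT (fun w => 'X^(descents 0 w))).
apply: perm_big; apply: uniq_perm; rewrite ?signed_words_uniq //.
  rewrite map_inj_in_uniq ?enum_uniq // => s t; rewrite !mem_enum.
  exact: signed_word_inj.
move=> w; apply/mapP/idP => [[s]|/signed_word_surj[s s_in ->]].
  by rewrite mem_enum => /signed_word_in ? ->.
by exists s; rewrite ?mem_enum.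
Qed.

End Hyperoctahedral.

Lemma eulerianB0 (R : comNzRingType) : eulerianB R 0 = 1.
Proof. by rewrite eulerianB_signed_words big_seq1 expr0. Qed.

Lemma eulerianBS (R : comNzRingType) n :
  eulerianB R n.+1 = eulerB_step n (eulerianB R n).
Proof. by rewrite !eulerianB_signed_words sum_signed_words_step. Qed.

(** * Growth of standard tableaux by one box *)

Section PartialTableaux.
Variable n : nat.
Implicit Types (T U : filling n) (r c : 'I_n).

(** Standard tableaux with [m] boxes, drawn in the [n x n] array whatever
    [m <= n] is: deleting the largest entry then stays within one type. *)
Definition partial_SYT (m : nat) : {set filling n} :=
  [set T : filling n |
    [&& ferrers T,
        [forall i : 'I_n.+1, (i != 0 :> nat)%N ==>
           (#|[set b : 'I_n * 'I_n | T b.1 b.2 == i]| == (i <= m)%N)],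
        rows_increasing T & cols_increasing T]].

(** The cardinality condition on the entries is replaced by its three useful
    consequences: a bound, injectivity on boxes, and surjectivity. *)
Record partial_tableau (m : nat) T : Prop := PartialTableau {
  box_rowlen : forall r c, box T (r, c) = (c < rowlen T r)%N;
  rowlen_anti : forall r r', (r <= r')%N -> (rowlen T r' <= rowlen T r)%N;
  entry_le : forall r c, (T r c <= m)%N;
  entry_inj : forall r c r' c', box T (r, c) -> T r c = T r' c' -> r = r' /\ c = c';
  entry_ex : forall i : 'I_n.+1, (0 < i <= m)%N -> exists r c, T r c = i;
  row_incr : forall r c c', (c < c')%N -> box T (r, c') -> (T r c < T r c')%N;
  col_incr : forall r r' c, (r < r')%N -> box T (r', c) -> (T r c < T r' c)%N
}.

Lemma partial_SYTP m T : reflect (partial_tableau m T) (T \in partial_SYT m).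
Proof.
rewrite inE; apply: (iffP and4P).
- case=> /andP[/forallP box_T /forallP anti_T] /forallP ent_T /forallP row_T /forallP col_T.
  split.
  + by move=> r c; have /forallP/(_ c)/eqP := box_T r.
  + by move=> r r' le_r; have /forallP/(_ r')/implyP/(_ le_r) := anti_T r.
  + move=> r c; rewrite leqNgt; apply/negP => lt_mT.
    have /implyP := ent_T (T r c); rewrite -lt0n (leq_trans _ lt_mT) // => /(_ isT).
    rewrite leqNgt lt_mT /= cards_eq0 => /eqP/setP/(_ (r, c)).
    by rewrite !inE eqxx.
  + move=> r c r' c' nz_T eq_T.
    have /implyP/(_ nz_T)/eqP card_T := ent_T (T r c).
    have /card_le1_eqP le1: (#|[set b : 'I_n * 'I_n | T b.1 b.2 == T r c]| <= 1)%N.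
      by rewrite card_T leq_b1.
    by have := le1 (r, c) (r', c'); rewrite !inE /= eq_T eqxx => /(_ isT isT) [-> ->].
  + move=> i /andP[i_gt0 le_im].
    have /implyP := ent_T i; rewrite -lt0n => /(_ i_gt0).
    by rewrite le_im => /cards1P[[r c]] /setP/(_ (r, c)); rewrite !inE eqxx => /eqP <-; exists r, c.
  + move=> r c c' lt_c b; have /forallP/(_ c)/forallP/(_ c')/implyP := row_T r.
    by apply; rewrite lt_c.
  + move=> r r' c lt_r b; have /forallP/(_ r')/forallP/(_ c)/implyP := col_T r.
    by apply; rewrite lt_r.
- case=> box_T anti_T le_T inj_T ex_T row_T col_T; split.
  + apply/andP; split; apply/forallP=> r; apply/forallP=> c.
      by rewrite box_T.
    by apply/implyP; apply: anti_T.
  + apply/forallP=> i; apply/implyP=> nz_i.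
    case: leqP => [le_im|lt_mi].
      have [|r [c T_rc]] := ex_T i; first by rewrite lt0n nz_i.
      apply/cards1P; exists (r, c); apply/setP=> -[r' c']; rewrite !inE /=.
      apply/eqP/eqP => [T_rc'|[-> ->] //].
      by have [||-> ->] := inj_T r' c' r c; rewrite /box /= ?T_rc' ?T_rc.
    rewrite cards_eq0; apply/eqP/setP=> -[r c]; rewrite !inE /=.
    by apply: contraTF lt_mi => /eqP <-; rewrite -leqNgt le_T.
  + apply/forallP=> r; apply/forallP=> c; apply/forallP=> c'.
    by apply/implyP=> /andP[]; apply: row_T.
  + apply/forallP=> r; apply/forallP=> r'; apply/forallP=> c.
    by apply/implyP=> /andP[]; apply: col_T.
Qed.

Lemma SYT_partial : SYT n = partial_SYT n.
Proof.
apply/setP=> T; rewrite !inE /entries_once.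
by under [in RHS]eq_forallb => i do rewrite -ltnS ltn_ord.
Qed.

Lemma card_ord_lt L : (L <= n)%N -> #|[set c : 'I_n | (c < L)%N]| = L.
Proof.
move=> le_Ln; rewrite cardsE -sum1_card /=.
by rewrite (big_ord_narrow le_Ln) sum1_card card_ord.
Qed.

Lemma rowlen_max T r : (rowlen T r <= n)%N.
Proof. by rewrite -[X in (_ <= X)%N]card_ord max_card. Qed.

Lemma rowlenE T r L :
  (L <= n)%N -> (forall c, box T (r, c) = (c < L)%N) -> rowlen T r = L.
Proof.
by move=> le_Ln box_T; rewrite -[RHS](card_ord_lt le_Ln); apply: eq_card => c; rewrite !inE.
Qed.

Lemma sum_rowlen m T :
  (m <= n)%N -> T \in partial_SYT m -> (\sum_r rowlen T r)%N = m.
Proof.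
move=> le_mn; rewrite inE => /and4P[_ /forallP ent_T _ _].
transitivity #|[set b : 'I_n * 'I_n | box T b]|.
  rewrite cardsE -sum1_card.
  rewrite -(pair_big_dep predT (fun r c => box T (r, c)) (fun _ _ => 1%N)) /=.
  by apply: eq_bigr => r _; rewrite sum1_card /rowlen cardsE.
rewrite cardsE -sum1_card (partition_big (fun b => T b.1 b.2) (fun i => (i != 0 :> nat)%N)) //=.
rewrite (eq_bigr (fun i : 'I_n.+1 => (i <= m)%N : nat)); last first.
  move=> i nz_i; have /implyP/(_ nz_i)/eqP <- := ent_T i.
  rewrite cardsE -sum1_card; apply: eq_bigl => b; rewrite -[LHS]/(box T b && (T b.1 b.2 == i)) -[RHS]/(T b.1 b.2 == i).
  by case: (eqVneq (T b.1 b.2) i) => [E|]; rewrite ?andbF // andbT /box E.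
transitivity (\sum_(i < n.+1 | (i != 0 :> nat)%N && (i < m.+1)%N) 1)%N.
  rewrite big_mkcond [RHS]big_mkcond /=; apply: eq_bigr => i _.
  by rewrite ltnS; case: (i == _ :> nat); case: leqP.
have le_mn1 : (m.+1 <= n.+1)%N by [].
rewrite (@big_ord_narrow_cond _ _ _ _ _ (fun i => i != 0%N :> nat) (fun=> 1%N) le_mn1) /=.
by rewrite big_mkcond big_ord_recl /= sum_nat_const card_ord muln1.
Qed.

Definition add_box T r (k : nat) : filling n :=
  \matrix_(i, j) if (i == r) && (j == rowlen T r :> nat) then inord k else T i j.

(** As row lengths weakly decrease, comparing with all the lower rows amounts
    to comparing with the one just below. *)
Definition addable T r : bool :=
  [forall r' : 'I_n, (r' < r)%N ==> (rowlen T r < rowlen T r')%N].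

Section AddBox.
Variables (m : nat) (T : filling n) (r : 'I_n).
Hypotheses (lt_mn : (m < n)%N) (T_m : T \in partial_SYT m).

Let T_tab : partial_tableau m T. Proof. exact/partial_SYTP. Qed.

Lemma rowlen_lt : (rowlen T r < n)%N.
Proof.
apply: leq_ltn_trans lt_mn; rewrite -(sum_rowlen (ltnW lt_mn) T_m).
by rewrite (bigD1 r) //= leq_addr.
Qed.

Let new_box r' c := (r' == r) && (c == rowlen T r :> nat).

Let add_boxE r' c : add_box T r m.+1 r' c = (if new_box r' c then m.+1 else T r' c) :> nat.
Proof. by rewrite mxE -/(new_box _ _); case: ifP => // _; rewrite inordK ?ltnS. Qed.

Let new_box0 r' c : new_box r' c -> T r' c = 0%N :> nat.
Proof.
case/andP=> /eqP-> /eqP eq_c; apply/eqP; rewrite -[_ == _]negbK.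
by rewrite -[_ != _]/(box T (r, c)) (box_rowlen T_tab) eq_c ltnn.
Qed.

Let box_add r' c : box (add_box T r m.+1) (r', c) = new_box r' c || box T (r', c).
Proof. by rewrite {1}/box /= add_boxE; case: (new_box r' c). Qed.

Lemma rowlen_add r' : rowlen (add_box T r m.+1) r' = (rowlen T r' + (r' == r))%N.
Proof.
apply: rowlenE => [|c].
  case: eqP => [->|_]; first by rewrite addn1 rowlen_lt.
  by rewrite addn0 -[X in (_ <= X)%N]card_ord max_card.
rewrite box_add (box_rowlen T_tab) /new_box; case: eqP => [->|_] /=; last by rewrite addn0.
by rewrite addn1 ltnS (leq_eqVlt c).
Qed.

Lemma restrict_add_box : restrict (add_box T r m.+1) m = T.
Proof.
apply/matrixP=> r' c; apply: val_inj; rewrite mxE (fun_if val) /= add_boxE.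
case: (boolP (new_box r' c)) => [new|_]; first by rewrite ltnn (new_box0 new).
by rewrite (entry_le T_tab).
Qed.

Lemma add_box_partial : addable T r -> add_box T r m.+1 \in partial_SYT m.+1.
Proof.
move=> /forallP add_r; apply/partial_SYTP; split.
- move=> r' c; rewrite box_add rowlen_add (box_rowlen T_tab) /new_box.
  by case: eqP => [->|_] /=; rewrite ?addn0 // addn1 ltnS (leq_eqVlt c).
- move=> r1 r2 le_r; rewrite !rowlen_add; have le_len := rowlen_anti T_tab le_r.
  case: (eqVneq r2 r) => [def_r|_]; last by rewrite addn0 (leq_trans le_len) ?leq_addr.
  case: (eqVneq r1 r) => [_|neq_r1]; first by rewrite leq_add2r.
  rewrite addn1 addn0 def_r; apply: (implyP (add_r r1)).
  by rewrite ltn_neqAle -def_r le_r andbT def_r neq_r1.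
- move=> r' c; rewrite add_boxE; case: ifP => // _.
  exact: leqW (entry_le T_tab _ _).
- move=> r1 c1 r2 c2 b /(congr1 val) /=; rewrite !add_boxE.
  have le_T := entry_le T_tab.
  case: ifP => new1; case: ifP => new2.
  + move=> _; case/andP: new1 => /eqP -> /eqP eq1; case/andP: new2 => /eqP -> /eqP eq2.
    by split=> //; apply: val_inj; rewrite /= eq1.
  + by have := le_T r2 c2; lia.
  + by have := le_T r1 c1; lia.
  + move=> /val_inj eq_T; apply: (entry_inj T_tab) => //.
    by move: b; rewrite box_add new1.
- move=> i /andP[i_gt0]; rewrite leq_eqVlt ltnS => /predU1P[eq_i|le_im].
    exists r, (Ordinal rowlen_lt); apply: val_inj.
    by rewrite /= add_boxE /new_box /= !eqxx.
  have [|r' [c T_rc]] := entry_ex T_tab (i := i); first by rewrite i_gt0.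
  exists r', c; apply: val_inj; rewrite /= add_boxE ifN ?T_rc //.
  by apply/negP=> /new_box0; rewrite T_rc => i0; rewrite i0 in i_gt0.
- move=> r' c c' lt_c b; rewrite !add_boxE; have le_T := entry_le T_tab.
  have old_c : ~~ new_box r' c.
    apply/negP=> /andP[/eqP def_r /eqP def_c]; move: b.
    rewrite box_add (box_rowlen T_tab) /new_box def_r eqxx /=; lia.
  rewrite (negPf old_c); case: ifP => new; first by rewrite ltnS le_T.
  by apply: (row_incr T_tab) => //; move: b; rewrite box_add new.
- move=> r1 r2 c lt_r b; rewrite !add_boxE; have le_T := entry_le T_tab.
  have old_r1 : ~~ new_box r1 c.
    apply/negP=> /andP[/eqP def_r /eqP def_c]; move: b.
    rewrite box_add (box_rowlen T_tab) /new_box -def_r.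
    have -> : (r2 == r1) = false by apply/negP=> /eqP eq_r; rewrite eq_r ltnn in lt_r.
    have := rowlen_anti T_tab (ltnW lt_r); rewrite def_c -def_r /=; lia.
  rewrite (negPf old_r1); case: ifP => new; first by rewrite ltnS le_T.
  by apply: (col_incr T_tab) => //; move: b; rewrite box_add new.
Qed.

Lemma add_box_le r' c : (add_box T r m.+1 r' c <= m.+1)%N.
Proof. by rewrite add_boxE; case: ifP => // _; apply: leqW (entry_le T_tab _ _). Qed.

(** The index of [i] only sees the subtableau of entries up to [i]. *)
Lemma box_sorting_add_old i :
  (0 < i <= m)%N -> box_sorting (add_box T r m.+1) i = box_sorting T i.
Proof.
case/andP=> i_gt0 le_im; rewrite /box_sorting.
have -> : restrict (add_box T r m.+1) i = restrict T i.
  apply/matrixP=> r' c; apply: val_inj; rewrite [in LHS]mxE [in RHS]mxE !(fun_if val) /= add_boxE.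
  by case: (boolP (new_box r' c)) => // new; rewrite (new_box0 new) ltnNge le_im leq0n.
suff -> : col_of (add_box T r m.+1) i = col_of T i by [].
rewrite /col_of; congr (if _ is Some b then _ else _); apply: eq_pick => -[r' c] /=.
rewrite add_boxE; case: ifP => // new.
by rewrite (new_box0 new); apply/eqP/eqP; lia.
Qed.

Lemma col_of_add_new : col_of (add_box T r m.+1) m.+1 = (rowlen T r).+1.
Proof.
rewrite /col_of; case: pickP => [[r' c] /=|/(_ (r, Ordinal rowlen_lt))].
  rewrite add_boxE; case: ifP => [/andP[_ /eqP->] //|_].
  by have := entry_le T_tab r' c; move=> le /eqP E; rewrite E ltnn in le.
by rewrite add_boxE /new_box /= !eqxx.
Qed.

Lemma restrict_add_new : restrict (add_box T r m.+1) m.+1 = add_box T r m.+1.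
Proof. by apply/matrixP=> r' c; rewrite mxE add_box_le. Qed.

Lemma col_len_add k :
  (k < n)%N ->
  col_len k.+1 (add_box T r m.+1) = #|[set r' | (k < rowlen T r' + (r' == r))%N]|.
Proof.
move=> lt_kn; rewrite /col_len.
rewrite -[RHS](card_imset _ (f := fun r' => (r', Ordinal lt_kn))); last by move=> ? ? [].
apply: eq_card => -[r' c]; rewrite !inE eqSS.
apply/andP/imsetP => [[/eqP def_k]|[r'']].
  rewrite box_add (box_rowlen T_tab) => b; exists r'; last by congr (_, _); apply: val_inj.
  rewrite inE -def_k; move: b; rewrite /new_box.
  by case: eqP => [->|]; rewrite /= ?addn0 // addn1 ltnS -leq_eqVlt.
rewrite inE => b [-> ->] /=; split=> //.
rewrite box_add (box_rowlen T_tab) /new_box /=; move: b.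
by case: eqP => [->|]; rewrite /= ?addn0 // addn1 ltnS -leq_eqVlt.
Qed.

Lemma nrows_le : (nrows T <= m)%N.
Proof.
rewrite -(sum_rowlen (ltnW lt_mn) T_m) /nrows cardsE -sum1_card big_mkcond.
by apply: leq_sum => r' _; rewrite unfold_in; case: ifP.
Qed.

(** The sorting index of the new entry counts choices.  If it extends a row of
    length [k > 0], it is the number of rows of that length before the
    insertion; if it starts a row, it is the number [m + 1 - nrows T] of factors
    still undifferentiated when [m + 1] factors are available. *)
Lemma box_sorting_add_new :
  box_sorting (add_box T r m.+1) m.+1 =
  if rowlen T r == 0%N then (m.+1 - nrows T)%N else nrows_of_len T (rowlen T r).
Proof.
rewrite /box_sorting restrict_add_new col_of_add_new /=.
have lt_rn := rowlen_lt; case: (posnP (rowlen T r)) => [r0|r_gt0].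
  rewrite col_len_add ?(leq_ltn_trans _ lt_rn) //.
  have -> : [set r' | (0 < rowlen T r' + (r' == r))%N] = r |: [set r' | (0 < rowlen T r')%N].
    by apply/setP=> r'; rewrite !inE addnC; case: eqP.
  rewrite cardsU1 inE r0 -/(nrows T); have := nrows_le; lia.
rewrite -{1}(prednK r_gt0) !col_len_add //; last by rewrite prednK // ltnW.
(* Column [k] has length [#|lower| + #|same|] and column [k+1], which received
   the new box, has length [#|lower| + 1]. *)
set lower := [set r' | (rowlen T r < rowlen T r')%N].
set same := [set r' | rowlen T r' == rowlen T r].
have -> : [set r' | ((rowlen T r).-1 < rowlen T r' + (r' == r))%N] = lower :|: same.
  apply/setP=> r'; rewrite !inE prednK // orbC (eq_sym (rowlen T r')) -leq_eqVlt.
  by case: eqP => [->|]; rewrite ?addn0 // leqnn leq_addr.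
have -> : [set r' | (rowlen T r < rowlen T r' + (r' == r))%N] = r |: lower.
  by apply/setP=> r'; rewrite !inE; case: eqP => [->|]; rewrite ?addn0 // addn1 leqnn.
rewrite cardsU1 inE ltnn cardsU.
have -> : lower :&: same = set0.
  by apply/setP=> r'; rewrite !inE; case: ltngtP.
have : (0 < #|same|)%N by apply/card_gt0P; exists r; rewrite inE.
rewrite cards0 -/(nrows_of_len T (rowlen T r)) -/same; rewrite /nrows_of_len -/same; lia.
Qed.

End AddBox.

(** The largest entry ends its row and its column, so deleting it leaves a
    standard tableau with an addable row. *)
Lemma remove_max m U :
  (m < n)%N -> U \in partial_SYT m.+1 ->
  restrict U m \in partial_SYT m /\
  exists2 r, addable (restrict U m) r & U = add_box (restrict U m) r m.+1.
Proof.
move=> lt_mn /partial_SYTP U_tab.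
have [|r0 [c0 U0]] := entry_ex U_tab (i := inord m.+1); first by rewrite inordK ?ltnS ?leqnn.
have {}U0 : U r0 c0 = m.+1 :> nat by rewrite U0 inordK ?ltnS.
have le_U := entry_le U_tab.
have b0 : box U (r0, c0) by rewrite /box U0.
have uniq0 r c : U r c = m.+1 :> nat -> r = r0 /\ c = c0.
  by move=> U_rc; apply: (entry_inj U_tab); [rewrite /box U_rc | apply: val_inj; rewrite /= U_rc U0].
have len0 : rowlen U r0 = c0.+1.
  apply/eqP; rewrite eqn_leq -(box_rowlen U_tab) b0 andbT leqNgt; apply/negP => lt_c.
  have lt_cn : (c0.+1 < n)%N by apply: leq_trans lt_c _; rewrite rowlen_max.
  have := row_incr U_tab (r := r0) (c := c0) (c' := Ordinal lt_cn) (ltnSn _).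
  rewrite (box_rowlen U_tab) lt_c => /(_ isT).
  by rewrite U0 ltnNge le_U.
set T := restrict U m.
have TE r c : T r c = (if U r c == m.+1 :> nat then 0%N else U r c) :> nat.
  by rewrite mxE; have := le_U r c; rewrite leq_eqVlt ltnS; case: eqP => [->|_ /= ->//]; rewrite ltnn.
have box_T r c : box T (r, c) = box U (r, c) && (U r c != m.+1 :> nat).
  by rewrite /box /= TE; case: (U r c == m.+1 :> nat); rewrite ?andbF ?andbT.
have TU r c : box T (r, c) -> T r c = U r c.
  by rewrite box_T => /andP[_ neq]; apply: val_inj; rewrite /= TE (negPf neq).
have T_le r c : (T r c <= U r c)%N by rewrite TE; case: ifP.
have lenT r : rowlen T r = (rowlen U r - (r == r0))%N.
  apply: rowlenE => [|c].
    by apply: leq_trans (leq_subr _ _) _; rewrite rowlen_max.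
  rewrite box_T (box_rowlen U_tab); case: (eqVneq r r0) => [->|neq_r].
    rewrite len0 subn1 ltnS /= ltn_neqAle andbC; congr (_ && _); congr (~~ _).
    by apply/eqP/eqP => [/uniq0[_ ->]//|/val_inj ->].
  rewrite subn0; case: eqP => [/uniq0[eq_r]|]; last by rewrite andbT.
  by rewrite eq_r eqxx in neq_r.
have len_gt r : (r0 < r)%N -> (rowlen U r < rowlen U r0)%N.
  move=> lt_r; rewrite len0 ltnS leqNgt -(box_rowlen U_tab); apply/negP => b.
  by have := col_incr U_tab lt_r b; rewrite U0 ltnNge le_U.
split.
  apply/partial_SYTP; split.
  - move=> r c; rewrite lenT box_T (box_rowlen U_tab); case: (eqVneq r r0) => [->|neq_r].
      rewrite len0 subn1 ltnS /= ltn_neqAle andbC; congr (_ && _); congr (~~ _).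
      by apply/eqP/eqP => [/uniq0[_ ->]//|/val_inj ->].
    rewrite subn0; case: eqP => [/uniq0[eq_r]|]; last by rewrite andbT.
    by rewrite eq_r eqxx in neq_r.
  - move=> r r' le_r; rewrite !lenT; have := rowlen_anti U_tab le_r.
    case: (eqVneq r r0) => [eq_r|_]; last by lia.
    case: (eqVneq r' r0) => [->|neq_r']; first by rewrite eq_r.
    have := len_gt r'; rewrite ltn_neqAle -eq_r le_r andbT.
    rewrite eq_sym (_ : (r' == r :> nat) = (r' == r0)) ?neq_r'; first by move=> /(_ isT); lia.
    by rewrite eq_r.
  - by move=> r c; rewrite mxE; case: ifP.
  - move=> r c r' c' b; have b' := b.
    rewrite box_T in b'; case/andP: b' => bU _.
    move=> eq_T; apply: (entry_inj U_tab) => //; rewrite -TU // eq_T TU //.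
    by rewrite /box /= -eq_T.
  - move=> i /andP[i_gt0 le_im].
    have [|r [c U_rc]] := entry_ex U_tab (i := i); first by rewrite i_gt0 leqW.
    by exists r, c; rewrite TU // box_T /box /= U_rc -lt0n i_gt0 neq_ltn ltnS le_im.
  - move=> r c c' lt_c b; rewrite (TU _ _ b); apply: leq_ltn_trans (T_le _ _) _.
    by apply: (row_incr U_tab) => //; move: b; rewrite box_T => /andP[].
  - move=> r r' c lt_r b; rewrite (TU _ _ b); apply: leq_ltn_trans (T_le _ _) _.
    by apply: (col_incr U_tab) => //; move: b; rewrite box_T => /andP[].
exists r0.
  apply/forallP=> r; apply/implyP=> lt_r; rewrite !lenT eqxx len0 subn1 /=.
  have := rowlen_anti U_tab (ltnW lt_r); rewrite len0.
  have -> : (r == r0) = false by apply/negP=> /eqP eq_r; rewrite eq_r ltnn in lt_r.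
  by rewrite subn0.
apply/matrixP=> r c; apply: val_inj; rewrite mxE lenT eqxx len0 subn1 /=.
case: ifP => [/andP[/eqP-> /eqP/val_inj->]|/negP neq]; first by rewrite U0 inordK ?ltnS.
by rewrite TE; case: eqP => // /uniq0[eq_r eq_c]; case: neq; rewrite eq_r eq_c !eqxx.
Qed.

(** The two previous constructions are inverse to each other; the row of the new
    box is recovered as the one whose length has grown. *)
Lemma sum_partial_SYT_step (V : nmodType) m (F : filling n -> V) :
  (m < n)%N ->
  \sum_(U in partial_SYT m.+1) F U =
  \sum_(T in partial_SYT m) \sum_(r | addable T r) F (add_box T r m.+1).
Proof.
move=> lt_mn.
rewrite (partition_big (fun U => restrict U m) (mem (partial_SYT m))); last first.
  by move=> U /(remove_max lt_mn)[].
apply: eq_bigr => T T_m.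
rewrite (eq_bigl (mem [set r | addable T r])); last by move=> r; rewrite /= inE.
rewrite -(big_imset F (h := fun r => add_box T r m.+1) (A := [set r | addable T r])) /=.
  - apply: eq_bigl => U; apply/andP/imsetP => [[U_m /eqP def_T]|[r]].
      have [_ [r add_r def_U]] := remove_max lt_mn U_m.
      by rewrite -def_T; exists r; rewrite ?inE.
    rewrite inE => add_r ->; split; first exact: add_box_partial.
    by rewrite (restrict_add_box r lt_mn T_m).
- move=> r r' _ _ /(congr1 (fun U => rowlen U r)).
  rewrite !rowlen_add // eqxx => /addnI; by case: eqP.
Qed.

End PartialTableaux.

(** * Gamma expansion and the weight of a tableau *)

(** The terms [(4 X)^j (1 + X)^q] of the gamma expansion. *)
Definition gamma_term (R : comNzRingType) (j q : nat) : {poly R} :=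
  ('X *+ 4) ^+ j * (1 + 'X) ^+ q.

(** In the variables [u] and [v] with [u^2 = X] and [v = 1 + X], the term is
    [4^j u^(2j) v^q], and the recurrence is the rule [u -> u v, v -> 4 u^2]
    applied to [4^j u^(2j+1) v^q], up to the common factor [u].  Each of the [q] factors [v] gives
    [4^(j+1) u^(2j+3) v^(q-1)] and each of the [2j+1] factors [u] gives
    [4^j u^(2j+1) v^(q+1)]. *)
Lemma eulerB_step_gamma (R : comNzRingType) (j q : nat) :
  eulerB_step (q + j.*2) (gamma_term R j q) =
  gamma_term R j.+1 q.-1 *+ q + gamma_term R j q.+1 *+ j.*2.+1.
Proof.
have doubleE k : (k.*2.+1)%:R = 1 + 2 * k%:R :> {poly R} by rewrite mulrS -mul2n natrM.
have deriv4X : ('X *+ 4)^`() = 4 :> {poly R} by rewrite derivMn derivX.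
have deriv1X : (1 + 'X)^`() = 1 :> {poly R} by rewrite derivD derivX derivC add0r.
rewrite /eulerB_step /gamma_term derivM !deriv_exp deriv4X deriv1X.
rewrite -(mulr_natr 'X (_.*2.+1)) -(mulr_natr _ j.*2.+1) !doubleE natrD -mul2n natrM.
rewrite -(mulr_natr _ q) -(mulr_natr _ j) -[(_ * _) *+ 2]mulr_natr -(mulr_natr 'X 4) -(mulr_natr 1 4).
case: j => [|j]; case: q => [|q] /=; rewrite !exprS ?expr0 ?[j.+1%:R]mulrS ?[q.+1%:R]mulrS; ring.
Qed.

Section TableauWeight.
Variable n : nat.
Implicit Types (T U : filling n) (r : 'I_n).

Definition nodd T : nat := \sum_r odd (rowlen T r).

Definition nhalf T : nat := \sum_r (rowlen T r)./2.

Definition sorting_weight m T : nat := \prod_(1 <= i < m.+1) box_sorting T i.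

(** A tableau with [m] boxes thus has a gamma term of total degree [m], and
    that term only depends on its shape. *)
Lemma nodd_nhalf m T :
  (m <= n)%N -> T \in partial_SYT n m -> (nodd T + (nhalf T).*2)%N = m.
Proof.
move=> le_mn T_m; rewrite -[RHS](sum_rowlen le_mn T_m) -muln2 big_distrl -big_split.
by apply: eq_bigr => r _; rewrite /= muln2 odd_double_half.
Qed.

(** Together with [addable_exists]: among the rows of a given length, exactly
    the lowest one is addable. *)
Lemma addable_unique T r r' :
  addable T r -> addable T r' -> rowlen T r = rowlen T r' -> r = r'.
Proof.
move=> /forallP add_r /forallP add_r' eq_len; apply: val_inj => /=.
case: (ltngtP r r') => // lt_r.
  by have /implyP/(_ lt_r) := add_r' r; rewrite eq_len ltnn.
by have /implyP/(_ lt_r) := add_r r'; rewrite eq_len ltnn.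
Qed.

Lemma addable_exists m T r' :
  T \in partial_SYT n m -> exists2 r, addable T r & rowlen T r = rowlen T r'.
Proof.
move=> /partial_SYTP T_tab.
case: (arg_minnP (P := fun r => rowlen T r == rowlen T r') val (eqxx _)) => r /eqP len_r min_r.
exists r => //; apply/forallP=> r1; apply/implyP=> lt_r.
rewrite ltn_neqAle (rowlen_anti T_tab (ltnW lt_r)) andbT.
apply: contraTneq lt_r => eq_len; rewrite -leqNgt; apply: min_r.
by rewrite -eq_len len_r.
Qed.

Lemma sum_addable (V : nmodType) m T (h : nat -> V) (r0 : 'I_n) :
  T \in partial_SYT n m ->
  \sum_(r | addable T r && (rowlen T r == rowlen T r0)) h (rowlen T r) = h (rowlen T r0).
Proof.
move=> T_m; have [r1 add_r1 len_r1] := addable_exists r0 T_m.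
rewrite (big_pred1 r1) ?len_r1 // => r; apply/andP/eqP => [[add_r /eqP len_r]|->].
  by apply: (addable_unique add_r add_r1); rewrite len_r.
by rewrite add_r1 len_r1.
Qed.

(** Since the sorting index counts the rows of the extended length, the weighted
    sum over the addable rows becomes a plain sum over all nonempty rows, as if
    a box could be put on any of them, plus one term for each of the
    [m + 1 - nrows T] spare factors. *)
Lemma sum_addable_sorting (V : nmodType) m T (h : nat -> V) :
  (m < n)%N -> T \in partial_SYT n m ->
  \sum_(r | addable T r) h (rowlen T r) *+ box_sorting (add_box T r m.+1) m.+1 =
  \sum_(r | (0 < rowlen T r)%N) h (rowlen T r) + h 0%N *+ (m.+1 - nrows T).
Proof.
move=> lt_mn T_m.
under eq_bigr => r _ do rewrite box_sorting_add_new //.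
rewrite (bigID (fun r => (0 < rowlen T r)%N)) /=; congr (_ + _).
  rewrite [RHS](eq_bigr (fun r0 =>
    \sum_(r | addable T r && (rowlen T r == rowlen T r0)) h (rowlen T r))); last first.
    by move=> r0 _; rewrite (sum_addable _ _ T_m).
  rewrite (exchange_big_dep (fun r => addable T r && (0 < rowlen T r)%N)) /=; last first.
    by move=> r0 r r0_gt0 /andP[-> /eqP->].
  apply: eq_bigr => r /andP[add_r r_gt0]; rewrite gtn_eqF // /nrows_of_len.
  rewrite add_r /= cardsE -sumr_const; apply: eq_bigl => r0.
  rewrite -[LHS]/(rowlen T r0 == rowlen T r) andbC eq_sym.
  by case: (eqVneq (rowlen T r) (rowlen T r0)) => //= <-.
(* An empty row is available because fewer than [n] boxes are filled. *)
have [r0 r0_0] : exists r0, rowlen T r0 = 0%N.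
  have lt_rows := leq_ltn_trans (nrows_le lt_mn T_m) lt_mn.
  have : (0 < #|~: [set r | (0 < rowlen T r)%N]|)%N.
    by have := cardsC [set r | (0 < rowlen T r)%N]; rewrite card_ord -/(nrows T); lia.
  by case/card_gt0P => r0; rewrite !inE lt0n negbK => /eqP; exists r0.
have := sum_addable h r0 T_m; rewrite r0_0 => <-; rewrite -sumrMnl.
apply: eq_big => r; first by rewrite lt0n negbK.
by rewrite -eqn0Ngt => /andP[_ ->].
Qed.

Lemma nodd_add m T r :
  (m < n)%N -> T \in partial_SYT n m ->
  nodd (add_box T r m.+1) = if odd (rowlen T r) then (nodd T).-1 else (nodd T).+1.
Proof.
move=> lt_mn T_m; rewrite /nodd !(bigD1 r (P := predT)) //=.
rewrite rowlen_add // eqxx addn1 /=.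
rewrite (eq_bigr (fun i => nat_of_bool (odd (rowlen T i)))).
  by case: (odd _).
by move=> i /negPf neq_i; rewrite rowlen_add // neq_i addn0.
Qed.

Lemma nhalf_add m T r :
  (m < n)%N -> T \in partial_SYT n m ->
  nhalf (add_box T r m.+1) = (odd (rowlen T r) + nhalf T)%N.
Proof.
move=> lt_mn T_m; rewrite /nhalf !(bigD1 r (P := predT)) //=.
rewrite rowlen_add // eqxx addn1 /= uphalf_half addnA; congr (_ + _)%N.
by apply: eq_bigr => i /negPf neq_i; rewrite rowlen_add // neq_i addn0.
Qed.

Lemma nodd_nrows T : (nodd T + \sum_(r | (0 < rowlen T r)%N) ~~ odd (rowlen T r))%N = nrows T.
Proof.
rewrite /nrows cardsE -sum1_card /nodd (bigID (fun r => (0 < rowlen T r)%N)) /=.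
rewrite [X in (_ + X + _)%N]big1 => [|r]; last by rewrite -eqn0Ngt => /eqP->.
rewrite addn0 -big_split; apply: eq_big => [r|r _]; first by rewrite unfold_in.
by case: (odd _).
Qed.

(** Extending an odd row, in [q] ways, and extending an even row, in
    [m + 1 - q = 2j + 1] ways when the unused factors are counted as empty rows,
    are the two moves of [eulerB_step_gamma]. *)
Lemma sum_add_gamma (R : comNzRingType) m T :
  (m < n)%N -> T \in partial_SYT n m ->
  \sum_(r | addable T r)
     gamma_term R (nhalf (add_box T r m.+1)) (nodd (add_box T r m.+1))
       *+ box_sorting (add_box T r m.+1) m.+1
  = eulerB_step m (gamma_term R (nhalf T) (nodd T)).
Proof.
move=> lt_mn T_m; set j := nhalf T; set q := nodd T.
pose h k := if odd k then gamma_term R j.+1 q.-1 else gamma_term R j q.+1.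
under eq_bigr => r _.
  rewrite nodd_add // nhalf_add //.
  have -> : gamma_term R (odd (rowlen T r) + nhalf T)
      (if odd (rowlen T r) then (nodd T).-1 else (nodd T).+1) = h (rowlen T r).
    by rewrite /h; case: (odd _).
  over.
rewrite sum_addable_sorting //= -[X in eulerB_step X](nodd_nhalf (ltnW lt_mn) T_m) eulerB_step_gamma.
rewrite (eq_bigr (fun r => gamma_term R j.+1 q.-1 *+ odd (rowlen T r)
                         + gamma_term R j q.+1 *+ ~~ odd (rowlen T r))); last first.
  by move=> r _; rewrite /h; case: (odd _); rewrite mulr1n mulr0n ?addr0 ?add0r.
rewrite big_split /= !sumrMnr -addrA -mulrnDr.
have -> : (\sum_(r | (0 < rowlen T r)%N) odd (rowlen T r))%N = q.
  rewrite /q /nodd [RHS](bigID (fun r => (0 < rowlen T r)%N)) /= [X in (_ + X)%N]big1 ?addn0 //.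
  by move=> r; rewrite -eqn0Ngt => /eqP->.
congr (_ + _ *+ _); have := nodd_nrows T; set even_rows := (X in (_ + X)%N = _).
have := nrows_le lt_mn T_m; rewrite -[X in _ -> _ -> (X + _)%N = _]/even_rows.
by have := nodd_nhalf (ltnW lt_mn) T_m; rewrite -/q -/j; lia.
Qed.

Lemma sorting_weight_add m T r :
  (m < n)%N -> T \in partial_SYT n m ->
  sorting_weight m.+1 (add_box T r m.+1) =
    (sorting_weight m T * box_sorting (add_box T r m.+1) m.+1)%N.
Proof.
move=> lt_mn T_m; rewrite /sorting_weight big_nat_recr //=; congr (_ * _)%N.
by apply: eq_big_nat => i i_le; rewrite box_sorting_add_old.
Qed.

Lemma partial_SYT0 : partial_SYT n 0 = [set 0].
Proof.
apply/setP=> T; rewrite in_set1; apply/partial_SYTP/eqP => [T_tab|->].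
  apply/matrixP=> r c; apply: val_inj; rewrite mxE /=.
  by have := entry_le T_tab r c; rewrite leqn0 => /eqP.
have len0 r : rowlen (0 : filling n) r = 0%N.
  by apply: rowlenE => // c; rewrite /box /= mxE.
by split=> [r c|r r' _|r c|r c r' c'|[[|i] lt_i] // /andP[]|r c c' _|r r' c _];
  rewrite ?len0 /box ?mxE.
Qed.

Lemma eulerianB_partial_SYT (R : comNzRingType) m :
  (m <= n)%N ->
  eulerianB R m =
  \sum_(T in partial_SYT n m) gamma_term R (nhalf T) (nodd T) *+ sorting_weight m T.
Proof.
elim: m => [|m IHm] lt_mn.
  rewrite eulerianB0 partial_SYT0 big_set1 /sorting_weight big_geq // mulr1n.
  have T_m : (0 : filling n) \in partial_SYT n 0 by rewrite partial_SYT0 set11.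
  have := nodd_nhalf (leq0n n) T_m.
  case: (nodd _) => //; case: (nhalf _) => // _.
  by rewrite /gamma_term !expr0 mulr1.
rewrite eulerianBS IHm ?(ltnW lt_mn) // eulerB_step_sum sum_partial_SYT_step //.
apply: eq_bigr => T T_m; rewrite eulerB_step_natZ -sum_add_gamma // -sumrMnl.
by apply: eq_bigr => r _; rewrite sorting_weight_add // mulnC mulrnA.
Qed.

(** Every row contributes [4] to the power half its length rounded down, then [1 + x] if it
    is odd and [sqrtx] if it is even.  The even rows and the [n - nrows T] spare
    factors [sqrtx] together give [sqrtx] to the power [n - q = 2j]. *)
Lemma prod_cweight (R : comNzRingType) (x sqrtx : R) T :
  sqrtx ^+ 2 = x -> T \in SYT n ->
  (\prod_(1 <= i < n.+1) cweight x sqrtx i ^+ nrows_of_len T i) * sqrtx ^+ (n - nrows T)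
  = (gamma_term R (nhalf T) (nodd T)).[x].
Proof.
rewrite SYT_partial => def_x T_n.
have sum_pos (f : nat -> nat) : f 0%N = 0%N ->
    (\sum_(r | (0 < rowlen T r)%N) f (rowlen T r) = \sum_r f (rowlen T r))%N.
  move=> f0; rewrite [RHS](bigID (fun r => (0 < rowlen T r)%N)) /= [X in (_ + X)%N]big1 ?addn0 //.
  by move=> r; rewrite -eqn0Ngt => /eqP->.
have -> : \prod_(1 <= i < n.+1) cweight x sqrtx i ^+ nrows_of_len T i
        = \prod_(r | (0 < rowlen T r)%N) cweight x sqrtx (rowlen T r).
  transitivity (\prod_(1 <= i < n.+1) \prod_(r | i == rowlen T r) cweight x sqrtx i).
    apply: eq_bigr => i _; rewrite prodr_const /nrows_of_len cardsE.
    by congr (_ ^+ _); apply: eq_card => r; apply: eq_sym.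
  rewrite (exchange_big_dep predT) //= [RHS]big_mkcond /=; apply: eq_bigr => r _.
  rewrite big_nat1_eq ltnS; have -> // : (rowlen T r <= n)%N.
    by rewrite rowlen_max.
  by rewrite andbT.
rewrite (eq_bigr (fun r => 4 ^+ (rowlen T r)./2 * (1 + x) ^+ odd (rowlen T r)
                           * sqrtx ^+ ~~ odd (rowlen T r))); last first.
  by move=> r _; rewrite /cweight -mulrA; case: odd; rewrite /= ?mulr1 ?mul1r.
rewrite !big_split /= -!expr_sum (sum_pos half) // (sum_pos (nat_of_bool \o odd)) //.
rewrite -[LHS]mulrA -exprD /gamma_term hornerM !horner_exp hornerMn hornerD hornerX hornerC.
have -> : (\sum_(r | 0 < rowlen T r) ~~ odd (rowlen T r) + (n - nrows T) = (nhalf T).*2)%N.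
  have := nodd_nhalf (leqnn n) T_n; have := nodd_nrows T.
  set even_rows := (X in (_ + X)%N = _).
  rewrite -[X in _ -> _ -> (X + _)%N = _]/even_rows.
  have : (nrows T <= n)%N by rewrite -[X in (_ <= X)%N]card_ord max_card.
  lia.
rewrite -/(nhalf T) -/(nodd T) -mul2n exprM def_x.
by rewrite mulrAC -exprMn mulr_natl.
Qed.

End TableauWeight.

Theorem theorem37 (R : comNzRingType) (n : nat) (hn : (1 <= n)%N)
  (x sqrtx : R) (hx : sqrtx ^+ 2 = x) :
  (eulerianB R n).[x] =
  \sum_(T in SYT n)
     (\prod_(1 <= i < n.+1)
         ((box_sorting T i)%:R * cweight x sqrtx i ^+ nrows_of_len T i))
     * sqrtx ^+ (n - nrows T).
Proof.
rewrite (eulerianB_partial_SYT _ (leqnn n)) -SYT_partial horner_sum.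
apply: eq_bigr => T T_in; rewrite big_split /= -mulrA (prod_cweight hx T_in).
by rewrite hornerMn -mulr_natl /sorting_weight natr_prod.
Qed.
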